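(* If $D$ is a tournament on $n$ vertices, then the multiplicity of $-1$ as a root of $A_D(t)$ equals $\lfloor n/2\rfloor$.
   Context: A tournament is an orientation of a complete graph. For an $n$-vertex digraph $D$, a descent of a bijection $\sigma:V(D)\to[n]$ is an arc $u\to v$ with $\sigma(u)>\sigma(v)$, $\mathrm{des}_D(\sigma)$ is the number of descents, and $A_D(t)=\sum_\sigma t^{\mathrm{des}_D(\sigma)}$ over all such bijections. *)

(* Defs.v *)
From mathcomp Require Import all_boot all_order all_algebra.
Set Implicit Arguments.
Unset Strict Implicit.
Unset Printing Implicit Defensive.
Import GRing.Theory.
Local Open Scope ring_scope.

(* A digraph on the vertex set V is given by its arc relation: D u v means
   u -> v. *)

Definition tournament (V : finType) (D : rel V) : Prop :=
  irreflexive D /\ (forall u v : V, u != v -> D u v (+) D v u).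

Definition bijectiveb (S T : finType) (f : {ffun S -> T}) : bool :=
  injectiveb f && [forall y : T, y \in codom f].

Lemma bijectivebP (S T : finType) (f : {ffun S -> T}) :
  reflect (bijective f) (bijectiveb f).
Proof.
apply: (iffP andP) => [[/injectiveP injf /forallP surjf]|bijf].
  exists (fun y => iinv (surjf y)) => [x|y]; last exact: f_iinv.
  by apply: injf; rewrite f_iinv.
split; first by apply/injectiveP; apply: bij_inj.
by case: bijf => g _ gK; apply/forallP => y; rewrite -(gK y) codom_f.
Qed.

(* The labels 1, ..., n are shifted to 0, ..., n - 1; this does not affect
   descents. *)
Definition des (V : finType) (D : rel V) (sigma : {ffun V -> 'I_#|V|}) : nat :=
  #|[set a : V * V | D a.1 a.2 & (sigma a.2 < sigma a.1)%N]|.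

Definition descent_poly (V : finType) (D : rel V) : {poly rat} :=
  \sum_(sigma : {ffun V -> 'I_#|V|} | bijectiveb sigma) 'X^(des D sigma).

(* Main.v *)
Require Import Defs.
From mathcomp Require Import all_boot all_order all_algebra.
From mathcomp Require Import zify.
Set Implicit Arguments.
Unset Strict Implicit.
Unset Printing Implicit Defensive.
Import GRing.Theory Num.Theory.
Local Open Scope ring_scope.

(** For a vertex set X let [A_X] be the descent polynomial of the induced
    subtournament.  Splitting labellings by the two lowest vertices x, y, in
    both orders, gives
      [A_X = (1 + t) * sum over pairs {x, y} of t^k(X,x,y) * A_(X - x - y)],
    where [k(X,x,y)] counts the arcs from [X - x - y] into [{x, y}].  Hence
    [A_X = (1 + t)^m B_X] for [#|X| = 2m], and [B_X(-1)] satisfies the same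
    recursion with signs [(-1)^k].  Reversing the order in which two disjoint
    pairs are removed changes [k] by an even amount, since four arcs join the
    pairs; so, as for a Pfaffian, [B_X(-1) = m! * G_X] where [G_X] may be
    expanded along any fixed vertex.  The expansion has [2m - 1] terms, so
    [G_X] is odd by induction, hence nonzero.  For an odd number of vertices,
    splitting off the lowest vertex writes [A_X] as [(1 + t)^m] times a sum of
    an odd number of terms whose values at -1 are [m!] times odd integers. *)

(** * Descent polynomials of induced subtournaments *)

Definition indegree (V : finType) (D : rel V) (X : {set V}) (x : V) : nat :=
  (\sum_(u in X) D u x)%N.

Definition pair_indegree (V : finType) (D : rel V) (X : {set V}) (x y : V)
    : nat :=
  (\sum_(u in X :\ x :\ y) (D u x + D u y))%N.

(* [s] lists the vertices by increasing label. *)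
Fixpoint seq_des (V : finType) (D : rel V) (s : seq V) : nat :=
  if s is x :: s' then (\sum_(u <- s') D u x + seq_des D s')%N else 0%N.

(** This is [A_X], with listings of [X] in place of bijections, so that no label type has to depend
    on [#|X|]. *)
Definition sub_poly (V : finType) (D : rel V) (X : {set V}) : {poly rat} :=
  \sum_(s <- permutations (enum X)) 'X^(seq_des D s).

Lemma sub_poly_set0 (V : finType) (D : rel V) : sub_poly D set0 = 1.
Proof. by rewrite /sub_poly enum_set0 big_seq1. Qed.

Lemma perm_rem_enum (V : finType) (X : {set V}) (x : V) :
  perm_eq (rem x (enum X)) (enum (X :\ x)).
Proof.
apply: uniq_perm; rewrite ?rem_uniq ?enum_uniq // => y.
by rewrite (mem_rem_uniq x (enum_uniq _)) !inE !mem_enum !inE.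
Qed.

Lemma tournament_arc (V : finType) (D : rel V) (x y : V) :
  tournament D -> x != y -> (D x y + D y x = 1)%N.
Proof. by case=> _ H /H; case: (D x y); case: (D y x). Qed.

(** If [x] has the lowest label, the descents at [x] are exactly the arcs into [x]. *)
Lemma sub_poly_rec (V : finType) (D : rel V) (X : {set V}) :
  irreflexive D -> X != set0 ->
  sub_poly D X = \sum_(x in X) 'X^(indegree D X x) * sub_poly D (X :\ x).
Proof.
move=> irrD X0; rewrite /sub_poly.
have sX : (0 < size (enum X))%N by rewrite -cardE card_gt0.
rewrite (perm_big _ (permutationsE sX)) /=.
rewrite big_allpairs_dep undup_id ?enum_uniq //.
rewrite -[RHS]big_enum big_seq [RHS]big_seq; apply: eq_bigr => x.
rewrite mem_enum => xX.
rewrite (perm_big _ (perm_permutations (perm_rem_enum X x))) mulr_sumr.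
rewrite big_seq [RHS]big_seq; apply: eq_bigr => s.
rewrite mem_permutations => sE; rewrite /= exprD; congr ('X^_ * _).
rewrite (perm_big _ sE) /= /indegree (big_setD1 x xX) /= irrD.
by rewrite -[RHS]big_enum.
Qed.

(** * Pair in-degrees and the Pfaffian-like expansion *)

Lemma indegreeD1 (V : finType) (D : rel V) (X : {set V}) (x y : V) :
  x \in X -> indegree D X y = (D x y + indegree D (X :\ x) y)%N.
Proof. by move=> xX; rewrite /indegree (big_setD1 x xX). Qed.

Lemma pair_indegreeC (V : finType) (D : rel V) (X : {set V}) (x y : V) :
  pair_indegree D X x y = pair_indegree D X y x.
Proof.
rewrite /pair_indegree; apply: eq_big => u; first by rewrite !inE andbCA.
by move=> _; rewrite addnC.
Qed.

(** Isolates [D y x] as the only contribution that depends on the order of the two lowest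
    vertices. *)
Lemma indegree_pair (V : finType) (D : rel V) (X : {set V}) (x y : V) :
  irreflexive D -> x \in X -> y \in X :\ x ->
  (indegree D X x + indegree D (X :\ x) y = pair_indegree D X x y + D y x)%N.
Proof.
move=> irrD xX yX; rewrite (indegreeD1 D x xX) irrD (indegreeD1 D x yX).
by rewrite (indegreeD1 D y yX) irrD /pair_indegree big_split /= /indegree; lia.
Qed.

(** Arcs from the other vertices count alike on both sides. Each of the four arcs between the pairs
    counts on exactly one side, and four is even. *)
Lemma pair_indegree_swap (V : finType) (D : rel V) (X : {set V}) (v w u z : V) :
  tournament D -> uniq [:: v; w; u; z] ->
  {subset [:: v; w; u; z] <= X} ->
  (-1) ^+ (pair_indegree D X v u + pair_indegree D (X :\ v :\ u) w z) =
  (-1) ^+ (pair_indegree D X w z + pair_indegree D (X :\ w :\ z) v u) :> int.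
Proof.
move=> tD /and4P[vs ws us _] sX.
have [vX wX uX zX] : [/\ v \in X, w \in X, u \in X & z \in X].
  by split; apply: sX; rewrite !inE eqxx ?orbT.
move: vs ws us; rewrite !inE !negb_or => /and3P[vw vu vz] /andP[wu wz] uz.
pose Y := X :\ v :\ u :\ w :\ z.
have YE : X :\ w :\ z :\ v :\ u = Y.
  by apply/setP => a; rewrite !inE; do 4!case: eqP.
have e1 : pair_indegree D X v u =
   (D w v + D w u + (D z v + D z u + \sum_(a in Y) (D a v + D a u)))%N.
  have wY : w \in X :\ v :\ u by rewrite !inE wu eq_sym vw.
  have zY : z \in X :\ v :\ u :\ w.
    by rewrite !inE zX !(eq_sym z) wz uz vz.
  by rewrite /pair_indegree (big_setD1 w wY) (big_setD1 z zY).
have e2 : pair_indegree D X w z =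
   (D v w + D v z + (D u w + D u z + \sum_(a in Y) (D a w + D a z)))%N.
  have vY : v \in X :\ w :\ z by rewrite !inE vz vw.
  have uY : u \in X :\ w :\ z :\ v.
    by rewrite !inE uX uz (eq_sym u w) wu (eq_sym u v) vu.
  by rewrite /pair_indegree (big_setD1 v vY) (big_setD1 u uY) /= YE.
rewrite e1 e2 /pair_indegree -/Y YE.
have := tournament_arc tD vw; have := tournament_arc tD vz.
have := tournament_arc tD uz; have := tournament_arc tD wu.
move: (\sum_(a in _) _)%N (\sum_(a in _) _)%N => A B h1 h2 h3 h4.
rewrite -signr_odd -[RHS]signr_odd !oddD; move: h1 h2 h3 h4.
by case: (D v w) (D w v) (D v z) (D z v) (D u z) (D z u) (D w u) (D u w)
  => [] [] [] [] [] [] [] [] // _ _ _ _; case: (odd A) (odd B) => [] [].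
Qed.

(** This is [G_X] for [#|X| = 2m], expanded along an arbitrary vertex. The value 0 arises only for
    empty [X] at positive [m], which this cardinality excludes. *)
Fixpoint sub_pf (V : finType) (D : rel V) (m : nat) (X : {set V}) : int :=
  if m is m'.+1 then
    if [pick v in X] is Some v then
      \sum_(u in X :\ v)
        (-1) ^+ pair_indegree D X v u * sub_pf D m' (X :\ v :\ u)
    else 0
  else 1.

Definition pf_row (V : finType) (D : rel V) (m : nat) (X : {set V}) (v : V) :=
  \sum_(u in X :\ v) (-1) ^+ pair_indegree D X v u * sub_pf D m (X :\ v :\ u).

Arguments sub_pf : simpl never.

Lemma sub_pfS (V : finType) (D : rel V) (m : nat) (X : {set V}) :
  sub_pf D m.+1 X = if [pick v in X] is Some v then pf_row D m X v else 0.
Proof. by []. Qed.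

Lemma cardsD2 (V : finType) (X : {set V}) (x y : V) :
  x \in X -> y \in X :\ x -> #|X| = #|X :\ x :\ y|.+2.
Proof. by move=> xX yX; rewrite (cardsD1 x) xX (cardsD1 y) yX. Qed.

(** The rows of [v] and [w] share the term of the pair [{v, w}]. Expanding each remaining term along
    the other vertex turns both rows into double sums over the partners of [v] and [w], which agree
    by [pair_indegree_swap]. *)
Lemma sub_pf_row (V : finType) (D : rel V) (m : nat) (X : {set V}) (v : V) :
  tournament D -> #|X| = m.+1.*2 -> v \in X -> sub_pf D m.+1 X = pf_row D m X v.
Proof.
move=> tD; elim: m X v => [|m IH] X v cX vX.
all: rewrite sub_pfS; case: pickP => [w wX|/(_ v)]; rewrite ?vX //.
all: have [->//|vw] := eqVneq v w.
all: have wv : w \in X :\ v by rewrite !inE eq_sym vw.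
all: have v_w : v \in X :\ w by rewrite !inE vw.
all: have YE : X :\ v :\ w = X :\ w :\ v
  by apply/setP => a; rewrite !inE andbCA.
all: rewrite /pf_row (big_setD1 v v_w) [RHS](big_setD1 w wv) /=.
all: rewrite pair_indegreeC YE; congr (_ + _).
  have -> : X :\ w :\ v = set0.
    apply/eqP; rewrite -cards_eq0.
    by have := cardsD2 wX v_w; rewrite cX => -[<-].
  by rewrite !big_set0.
have cD x y : x \in X -> y \in X :\ x -> #|X :\ x :\ y| = m.+1.*2.
  by move=> xX yX; have := cardsD2 xX yX; rewrite cX => -[<-].
have rowE a b : a \in X -> b \in X -> a != b ->
  \sum_(u in X :\ a :\ b) (-1) ^+ pair_indegree D X a u *
     sub_pf D m.+1 (X :\ a :\ u) =
  \sum_(u in X :\ a :\ b) \sum_(z in X :\ a :\ b :\ u)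
     (-1) ^+ (pair_indegree D X a u + pair_indegree D (X :\ a :\ u) b z) *
     sub_pf D m (X :\ a :\ u :\ b :\ z).
  move=> aX bX ab; apply: eq_bigr => u; rewrite !inE => /and3P[ub ua uX].
  have bY : b \in X :\ a :\ u by rewrite !inE eq_sym ub eq_sym ab.
  rewrite (IH _ b) ?cD // ?inE ?ua // mulr_sumr.
  apply: eq_big => z; first by rewrite !inE andbCA.
  by move=> _; rewrite exprD mulrA.
rewrite (rowE w v) // 1?eq_sym // -YE (rowE v w) //.
rewrite [RHS](exchange_big_dep (mem (X :\ v :\ w))) /=; last first.
  by move=> u z _; rewrite !inE => /and4P[_ -> -> ->].
(* On both sides [u] is now the partner of [w], and [z] below that of [v]. *)
apply: eq_bigr => u; rewrite !inE => /and3P[uw uv uX].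
apply: eq_big => z.
  rewrite !inE uw uv uX (eq_sym u z).
  by do !case: (_ == _); case: (_ \in _).
rewrite !inE => /and4P[zu zw zv zX]; congr (_ * _).
  apply: pair_indegree_swap => //.
    rewrite /= !inE !negb_or [w == v]eq_sym [w == u]eq_sym [w == z]eq_sym.
    by rewrite [v == u]eq_sym [v == z]eq_sym [u == z]eq_sym vw uw zw uv zv zu.
  by apply/allP; rewrite /= wX vX uX zX.
by congr (sub_pf D m _); apply/setP => a; rewrite !inE; do 4!case: eqP.
Qed.

(** * Parity of the Pfaffian-like sum *)

Lemma signr_F2 (k : nat) : (-1) ^+ k = 1 :> 'F_2.
Proof. by rewrite (_ : -1 = 1) ?expr1n //; apply/val_inj. Qed.

Lemma natr_F2 (k : nat) : k%:R = (odd k)%:R :> 'F_2.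
Proof.
rewrite -{1}(odd_double_half k) natrD -muln2 natrM (_ : 2%:R = 0).
  by rewrite mulr0 addr0.
by apply/val_inj.
Qed.

(** Signs disappear in ['F_2], so by induction a row is a sum of ones, and their number is odd. *)
Lemma sub_pf_odd (V : finType) (D : rel V) (m : nat) (X : {set V}) :
  tournament D -> #|X| = m.*2 -> (sub_pf D m X)%:~R = 1 :> 'F_2.
Proof.
move=> tD; elim: m X => [|m IH] X cX; first by rewrite mulr1z.
have /set0Pn[v vX] : X != set0 by rewrite -card_gt0 cX.
rewrite (sub_pf_row (v := v)) // /pf_row rmorph_sum /=.
rewrite (eq_bigr (fun=> 1)); last first.
  move=> u uX; rewrite rmorphM /= IH ?mulr1 ?rmorphXn /= ?rmorphN1 ?signr_F2 //.
  by have := cardsD2 vX uX; rewrite cX => -[<-].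
have cv : #|X :\ v| = m.*2.+1 by have := cardsD1 v X; rewrite cX vX; lia.
by rewrite big_const iter_addr_0 natr_F2 cv /= odd_double.
Qed.

(** * Factoring out powers of [1 + t] *)

(* The sum runs over ordered pairs, hence the factor 1/2. *)
Fixpoint sub_quo (V : finType) (D : rel V) (m : nat) (X : {set V})
    : {poly rat} :=
  if m is m'.+1 then
    2^-1 *: \sum_(x in X) \sum_(y in X :\ x)
      'X^(pair_indegree D X x y) * sub_quo D m' (X :\ x :\ y)
  else 1.

(* Exchanging the two lowest vertices x, y of a labelling only toggles the
   descent on the arc between them, whence the factor [1 + 'X]. *)
Lemma sub_poly_pair (V : finType) (D : rel V) (X : {set V}) :
  tournament D -> (1 < #|X|)%N ->
  2 *: sub_poly D X = ('X + 1) * \sum_(x in X) \sum_(y in X :\ x)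
    'X^(pair_indegree D X x y) * sub_poly D (X :\ x :\ y).
Proof.
move=> tD cX; have [irrD _] := tD.
pose F x y := 'X^(pair_indegree D X x y) * sub_poly D (X :\ x :\ y).
have E : sub_poly D X = \sum_(x in X) \sum_(y in X :\ x) 'X^(D y x) * F x y.
  rewrite sub_poly_rec //; last by rewrite -card_gt0 ltnW.
  apply: eq_bigr => x xX; rewrite sub_poly_rec //; last first.
    by rewrite -card_gt0; move: cX; rewrite (cardsD1 x) xX.
  rewrite mulr_sumr; apply: eq_bigr => y yX.
  by rewrite /F !mulrA -!exprD indegree_pair // addnC.
have E' : sub_poly D X = \sum_(x in X) \sum_(y in X :\ x) 'X^(D x y) * F x y.
  rewrite E (exchange_big_dep (mem X)) /=; last first.
    by move=> x y _; rewrite !inE => /andP[].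
  apply: eq_bigr => y yX; apply: eq_big => x.
    by rewrite !inE yX andbT andbC eq_sym.
  move=> _; rewrite /F pair_indegreeC; congr (_ * (_ * sub_poly D _)).
  by apply/setP => a; rewrite !inE andbCA.
rewrite scaler_nat mulr2n {1}E E' -big_split mulr_sumr; apply: eq_bigr => x xX.
rewrite -big_split mulr_sumr; apply: eq_bigr => y.
rewrite !inE => /andP[yx yX] /=.
rewrite -mulrDl -/(F x y); congr (_ * _).
have := tournament_arc tD yx.
by case: (D y x); case: (D x y) => // _; rewrite expr0 expr1 // addrC.
Qed.

Lemma sub_polyE (V : finType) (D : rel V) (m : nat) (X : {set V}) :
  tournament D -> #|X| = m.*2 -> sub_poly D X = ('X + 1) ^+ m * sub_quo D m X.
Proof.
move=> tD; elim: m X => [|m IH] X cX.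
  by move/eqP: cX; rewrite cards_eq0 => /eqP->; rewrite sub_poly_set0 mulr1.
(* Doubling cancels the factor 1/2 in [sub_quo] and matches the ordered pairs in [sub_poly_pair]. *)
apply: (@scalerI _ _ (2 : rat)) => //.
rewrite sub_poly_pair ?cX // exprS -mulrA scalerAr /=; congr (_ * _).
rewrite -scalerAr scalerA mulfV // scale1r mulr_sumr; apply: eq_bigr => x xX.
rewrite mulr_sumr; apply: eq_bigr => y yX.
rewrite IH ?mulrA; first by congr (_ * _); rewrite mulrC.
by have := cardsD2 xX yX; rewrite cX => -[<-].
Qed.

(** At -1 the inner sum for each [x] is the row of [x], so all [2m + 2] of them equal [m! * G_X];
    half their total is [(m + 1)! * G_X]. *)
Lemma sub_quo_horner (V : finType) (D : rel V) (m : nat) (X : {set V}) :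
  tournament D -> #|X| = m.*2 ->
  (sub_quo D m X).[-1] = (m`!)%:R * (sub_pf D m X)%:~R.
Proof.
move=> tD; elim: m X => [|m IH] X cX; first by rewrite /= hornerC mulr1.
have rowE x : x \in X ->
    (\sum_(y in X :\ x)
       'X^(pair_indegree D X x y) * sub_quo D m (X :\ x :\ y)).[-1]
    = (m`!)%:R * (sub_pf D m.+1 X)%:~R.
  move=> xX; rewrite (sub_pf_row (v := x)) // /pf_row rmorph_sum /= mulr_sumr.
  rewrite horner_sum; apply: eq_bigr => y yX.
  rewrite hornerM hornerXn IH; last first.
    by have := cardsD2 xX yX; rewrite cX => -[<-].
  by rewrite rmorphM rmorphXn /= rmorphN1 mulrCA.
rewrite [sub_quo _ _ _]/= hornerZ horner_sum (eq_bigr _ rowE).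
rewrite big_const iter_addr_0 cX.
rewrite -[X in _ * X]mulr_natl -mul2n (natrM _ 2) factS natrM !mulrA.
by rewrite mulVf // mul1r.
Qed.

(** * Multiplicity of the root -1 *)

Lemma mup_XsubCX_mul (F : fieldType) (x : F) (m : nat) (q : {poly F}) :
  q.[x] != 0 -> mup x (('X - x%:P) ^+ m * q) = m.
Proof. by move=> qx; rewrite mupMl ?mup_XsubCX ?eqxx. Qed.

Lemma intr_F2_neq0 (z : int) : z%:~R = 1 :> 'F_2 -> z != 0.
Proof. by move=> z1; apply: contra_eq_neq z1 => ->. Qed.

Lemma mup_sub_poly (V : finType) (D : rel V) (X : {set V}) :
  tournament D -> mup (-1) (sub_poly D X) = (#|X| %/ 2)%N.
Proof.
move=> tD; set m := (#|X| %/ 2)%N.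
have mf : (m`!)%:R != 0 :> rat by rewrite pnatr_eq0 -lt0n fact_gt0.
(* For both parities of [#|X|] it suffices that the cofactor takes at -1 the value [m!] times an odd
   integer [z]. *)
suff [q -> [z qE z1]] : exists2 q, sub_poly D X = ('X + 1) ^+ m * q &
    exists2 z : int, q.[-1] = (m`!)%:R * z%:~R & z%:~R = 1 :> 'F_2.
  rewrite (_ : 'X + 1 = 'X - (-1)%:P); last by rewrite polyCN opprK.
  by rewrite mup_XsubCX_mul // qE mulf_neq0 // intr_eq0 intr_F2_neq0.
have [oX|eX] := boolP (odd #|X|); last first.
  have cX : #|X| = m.*2 by rewrite /m; lia.
  exists (sub_quo D m X); first exact: sub_polyE.
  by exists (sub_pf D m X); [exact: sub_quo_horner | exact: sub_pf_odd].
have cD x : x \in X -> #|X :\ x| = m.*2.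
  by move=> xX; have := cardsD1 x X; rewrite xX /m; lia.
exists (\sum_(x in X) 'X^(indegree D X x) * sub_quo D m (X :\ x)).
  rewrite sub_poly_rec; [|by case: tD|by rewrite -card_gt0 odd_gt0].
  rewrite mulr_sumr; apply: eq_bigr => x xX.
  by rewrite (sub_polyE tD (cD _ xX)) mulrCA.
exists (\sum_(x in X) (-1) ^+ indegree D X x * sub_pf D m (X :\ x)).
  rewrite horner_sum rmorph_sum mulr_sumr; apply: eq_bigr => x xX /=.
  rewrite hornerM hornerXn (sub_quo_horner tD (cD _ xX)).
  by rewrite rmorphM rmorphXn /= rmorphN1 mulrCA.
rewrite rmorph_sum /= (eq_bigr (fun=> 1)); last first.
  move=> x xX; rewrite rmorphM /= (sub_pf_odd tD (cD _ xX)) mulr1.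
  by rewrite rmorphXn /= rmorphN1 signr_F2.
by rewrite big_const iter_addr_0 natr_F2 oX.
Qed.

(** * Labellings as listings of the vertices *)

(** The default [enum_rank v] is never returned when [s] lists all vertices. *)
Definition seq_labelling (V : finType) (s : seq V) : {ffun V -> 'I_#|V|} :=
  [ffun v => insubd (enum_rank v) (index v s)].

Lemma perm_enumP (V : finType) (s : seq V) :
  perm_eq s (enum [set: V]) -> [/\ uniq s, size s = #|V| & forall v, v \in s].
Proof.
move=> sE; split; first by rewrite (perm_uniq sE) enum_uniq.
  by rewrite (perm_size sE) -cardE cardsT.
by move=> v; rewrite (perm_mem sE) mem_enum inE.
Qed.

Lemma seq_labellingE (V : finType) (s : seq V) (v : V) :
  perm_eq s (enum [set: V]) -> seq_labelling s v = index v s :> nat.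
Proof.
move=> /perm_enumP[_ ss ms].
by rewrite ffunE val_insubd ifT // -ss index_mem.
Qed.

Lemma seq_labelling_inj (V : finType) (s t : seq V) :
  perm_eq s (enum [set: V]) -> perm_eq t (enum [set: V]) ->
  seq_labelling s = seq_labelling t -> s = t.
Proof.
move=> sE tE st; have [us ss _] := perm_enumP sE.
have [_ ts mt] := perm_enumP tE.
have [/size0nil s0|] := posnP (size s).
  by move: ts; rewrite -ss s0 => /size0nil.
case: {1}s => // x0 _ _.
apply: (@eq_from_nth _ x0) => [|i lis]; first by rewrite ss ts.
rewrite -{1}(nth_index x0 (mt (nth x0 s i))).
by rewrite -(seq_labellingE _ tE) -st (seq_labellingE _ sE) index_uniq.
Qed.

(** The head has index 0, so no descent leaves it and every arc from the tail into it is one; in the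
    tail all indices shift by one. *)
Lemma seq_desE (V : finType) (D : rel V) (s : seq V) :
  uniq s ->
  seq_des D s =
    (\sum_(a <- s) \sum_(b <- s) (D a b && (index b s < index a s)))%N.
Proof.
elim: s => [|x s IH] /=; first by rewrite big_nil.
case/andP=> xs us; rewrite IH // big_cons.
rewrite [X in _ = (X + _)%N]big1_seq; last first.
  by move=> b _ /=; rewrite eqxx ltn0 andbF.
rewrite add0n -big_split /= big_seq [RHS]big_seq; apply: eq_bigr => a as_.
have xa : (x == a) = false by apply: contraNF xs => /eqP->.
rewrite big_cons eqxx xa ltnS leq0n andbT; congr (_ + _)%N.
rewrite big_seq [RHS]big_seq; apply: eq_bigr => b bs.
by have -> : (x == b) = false by apply: contraNF xs => /eqP->.
Qed.

Lemma des_seq_labelling (V : finType) (D : rel V) (s : seq V) :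
  perm_eq s (enum [set: V]) -> des D (seq_labelling s) = seq_des D s.
Proof.
move=> sE; have [us _ _] := perm_enumP sE.
rewrite seq_desE // (perm_big _ sE) big_enum /=.
under eq_bigr do rewrite (perm_big _ sE) big_enum /=.
rewrite /des -sum1_card pair_big /= [RHS]big_mkcond [LHS]big_mkcond /=.
by apply: eq_bigr => -[a b] _ /=; rewrite !inE /= !seq_labellingE.
Qed.

Lemma descent_polyE (V : finType) (D : rel V) :
  descent_poly D = sub_poly D [set: V].
Proof.
rewrite /descent_poly /sub_poly.
transitivity (
    \sum_(f <- [seq seq_labelling s | s <- permutations (enum [set: V])])
    ('X^(des D f) : {poly rat})); last first.
  rewrite big_map big_seq [RHS]big_seq; apply: eq_bigr => s.
  by rewrite mem_permutations => sE; rewrite des_seq_labelling.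
(* It remains to compare two duplicate-free lists of labellings elementwise. *)
rewrite -[LHS]big_enum; apply: perm_big.
apply: uniq_perm; first exact: enum_uniq.
  by rewrite map_inj_in_uniq ?permutations_uniq // => s t;
    rewrite !mem_permutations; exact: seq_labelling_inj.
move=> f; rewrite mem_enum; apply/bijectivebP/mapP => [[g fK gK]|[s]].
  have gI := can_inj gK.
  have gE : perm_eq [seq g i | i <- enum 'I_#|V|] (enum [set: V]).
    apply: uniq_perm => [||v]; [|exact: enum_uniq|].
      by rewrite (map_inj_uniq gI); exact: enum_uniq.
    by rewrite mem_enum inE -(fK v) map_f ?mem_enum.
  (* The inverse [g] of the labelling, read along the labels in increasing order, is the required
     listing. *)
  exists [seq g i | i <- enum 'I_#|V|]; first by rewrite mem_permutations.
  apply/ffunP => v; apply: val_inj; rewrite /= seq_labellingE // -{2}(fK v).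
  by rewrite index_map ?index_enum_ord.
rewrite mem_permutations => sE ->; have [us ss ms] := perm_enumP sE.
apply: inj_card_bij; last by rewrite card_ord.
move=> u v /(congr1 val) /=; rewrite !seq_labellingE // => uv.
exact: (index_inj u (ms u) (ms v)).
Qed.

Theorem theorem1p9 (n : nat) (V : finType) (D : rel V) :
  #|V| = n -> tournament D -> mup (-1) (descent_poly D) = (n %/ 2)%N.
Proof.
by move=> <- tD; rewrite descent_polyE mup_sub_poly ?cardsT.
Qed.
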